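(* Let $G$ be a topological group and let $R$ be a directed poset. Let $\{A_r,\varphi_{rs},R\}$ be an inverse system of compact $G$-groups whose transition maps are $G$-group homomorphisms, and let $A=\varprojlim_{r\in R}A_r$ be a compact $G$-group presented as its inverse limit, with natural projections $\varphi_r:A\to A_r$. Then there exists a natural continuous bijection $$\Theta: H^1_{\mathrm{cts}}(G,A)_{\mathrm{po}}\longrightarrow \varprojlim_{r\in R}H^1_{\mathrm{cts}}(G,A_r)_{\mathrm{po}}\quad\text{given by}\quad [a]\longmapsto([\varphi_{r*}(a)])_{r\in R}.$$ In particular, if $G$ is a compact (or even only locally compact) Hausdorff space and $A$ is evenly continuous with respect to $G$, then $\Theta$ is a homeomorphism.
   Context: A $G$-group is a Hausdorff topological group $A$ with a continuous left action $G\times A\to A$, $(s,x)\mapsto {}^s x$, such that ${}^s(xy)={}^sx\,{}^sy$ for all $s\in G$, $x,y\in A$. A $G$-group homomorphism is a continuous group homomorphism commuting with the $G$-actions. For topological spaces $A,B$, $M(B,A)_{\mathrm{po}}$ is the set of all maps $B\to A$ with the point-open topology (topology of pointwise convergence, i.e. the product topology on $\prod_{b\in B}A$), and $M_{\mathrm{cts}}(B,A)_{\mathrm{po}}$ is the subspace of continuous maps. $Z^1_{\mathrm{cts}}(G,A)_{\mathrm{po}}=\{a\in M_{\mathrm{cts}}(G,A): a_{st}=a_s\,{}^sa_t\ \forall s,t\in G\}$, with the subspace topology from $M_{\mathrm{cts}}(G,A)_{\mathrm{po}}$. The group $A$ acts on it on the right by $(a.x)_s=x^{-1}a_s\,{}^sx$,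 and $H^1_{\mathrm{cts}}(G,A)_{\mathrm{po}}=Z^1_{\mathrm{cts}}(G,A)_{\mathrm{po}}/A$ is the orbit space with the quotient topology; $[a]$ denotes the class of $a$. A $G$-group homomorphism $\varphi:A\to A'$ induces $\varphi_*(a)=\varphi\circ a$ on cocycles and $[a]\mapsto[\varphi_*(a)]$ on classes; the inverse limit of the spaces $H^1_{\mathrm{cts}}(G,A_r)_{\mathrm{po}}$ is taken along the maps induced by the $\varphi_{rs}$. A subset $F\subseteq M(B,A)$ is evenly continuous if for each $b\in B$, each $a\in A$ and each neighbourhood $U$ of $a$ there exist a neighbourhood $V$ of $b$ and a neighbourhood $W$ of $a$ such that for all $f\in F$, $f(b)\in W$ implies $f(V)\subseteq U$. The space $A$ is evenly continuous with respect to $B$ if $M_{\mathrm{cts}}(B,A)$ is evenly continuous. *)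

(* Defs.v *)
From HB Require Import structures.
From mathcomp Require Import all_boot all_order.
From mathcomp Require Import all_classical topology.

Set Implicit Arguments.
Unset Strict Implicit.
Unset Printing Implicit Defensive.

Local Open Scope classical_set_scope.
Local Open Scope group_scope.
Local Open Scope quotient_scope.

HB.structure Definition PreTopologicalGroup :=
  {G of monoid.Group G & Topological G}.

HB.mixin Record PreTopologicalGroup_isTopologicalGroup G
    & PreTopologicalGroup G := {
  mulg_continuous : continuous (fun p : G * G => p.1 * p.2);
  invg_continuous : continuous (fun x : G => x^-1)
}.

#[short(type="topologicalGroupType")]
HB.structure Definition TopologicalGroup :=
  {G of PreTopologicalGroup G & PreTopologicalGroup_isTopologicalGroup G}.

HB.mixin Record TopologicalGroup_isGGroup (G : topologicalGroupType) A
    & TopologicalGroup A := {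
  gact : G -> A -> A;
  gact1 : forall x, gact 1 x = x;
  gactA : forall s t x, gact (s * t) x = gact s (gact t x);
  gactM : forall s x y, gact s (x * y) = gact s x * gact s y;
  gact_continuous : continuous (fun p : G * A => gact p.1 p.2);
  ggroup_hausdorff : hausdorff_space A
}.

#[short(type="gGroupType")]
HB.structure Definition GGroup (G : topologicalGroupType) :=
  {A of TopologicalGroup A & TopologicalGroup_isGGroup G A}.

HB.mixin Record isEquivariant (G : topologicalGroupType) (A B : gGroupType G)
    (f : A -> B) := {
  gact_equivariant : forall s x, f (gact s x) = gact s (f x)
}.

#[short(type="gGroupHom")]
HB.structure Definition GGroupHom (G : topologicalGroupType)
    (A B : gGroupType G) :=
  {f of isMultiplicative A B f & @isContinuous A B f
      & isEquivariant G A B f}.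

Definition homeomorphism (X Y : topologicalType) (f : X -> Y) :=
  continuous f /\ exists g : Y -> X, [/\ continuous g, cancel f g & cancel g f].

Section InverseSystem.
Context {d : Order.disp_t} (R : porderType d).

Definition directed := forall r s : R, exists t : R, (r <= t)%O /\ (s <= t)%O.

(* The transition map of r and s goes from X r to X s when s <= r. *)
Definition is_inverse_system (X : R -> Type)
    (f : forall r s, (s <= r)%O -> X r -> X s) :=
  (forall r (rr : (r <= r)%O) x, f r r rr x = x) /\
  (forall r s t (sr : (s <= r)%O) (ts : (t <= s)%O) (tr : (t <= r)%O) x,
    f s t ts (f r s sr x) = f r t tr x).

Definition inverse_limit (X : R -> topologicalType)
    (f : forall r s, (s <= r)%O -> X r -> X s) : set (prod_topology X) :=
  [set x | forall r s (sr : (s <= r)%O), f r s sr (x r) = x s].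

(* Since the projections are homomorphisms of G-groups, the structure of
   G-group of [A] is then also the one of the limit. *)
Definition is_inverse_limit (X : R -> topologicalType)
    (f : forall r s, (s <= r)%O -> X r -> X s)
    (A : topologicalType) (p : forall r, A -> X r) :=
  exists Phi : A -> inverse_limit f,
    homeomorphism Phi /\ forall x r, \val (Phi x) r = p r x.

End InverseSystem.
Arguments is_inverse_system {d R X}.
Arguments inverse_limit {d R X}.
Arguments is_inverse_limit {d R X} f {A}.

Definition evenly_continuous (B A : topologicalType) (F : set (B -> A)) :=
  forall (b : B) (a : A) (U : set A), nbhs a U ->
    exists V W, [/\ nbhs b V, nbhs a W &
      forall f, F f -> W (f b) -> f @` V `<=` U].

Definition Mcts (B A : topologicalType) : set {ptws B -> A} :=
  [set f | continuous (f : B -> A)].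

Definition evenly_continuous_wrt (A B : topologicalType) :=
  evenly_continuous (@Mcts B A).

Section Cohomology.
Context {G : topologicalGroupType}.

(* The subspace topology is inherited from {ptws G -> A} directly rather than
   through the subspace of continuous maps. *)
Definition Z1_set (A : gGroupType G) : set {ptws G -> A} :=
  [set a | Mcts a /\ forall s t : G, a (s * t) = a s * gact s (a t)].

Definition Z1 (A : gGroupType G) : topologicalType := set_type (@Z1_set A).

Section Action.
Variable A : gGroupType G.

Definition Z1_act_fun (a : G -> A) (x : A) : {ptws G -> A} :=
  fun s => x^-1 * a s * gact s x.

Lemma mulg_cvg (T : topologicalType) (f g : T -> A) :
  continuous f -> continuous g -> continuous (fun t => f t * g t).
Proof.
move=> cf cg t.
by apply: (@continuous2_cvg _ A A A _ _ f g (fun x y => x * y));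
  [exact: (@mulg_continuous A (f t, g t)) | exact: cf | exact: cg].
Qed.

Lemma Z1_act_proof (a : Z1 A) (x : A) : Z1_act_fun (\val a) x \in @Z1_set A.
Proof.
case: a => a /= /set_mem [ac acc]; apply/mem_set; split.
  apply: mulg_cvg; first by apply: mulg_cvg => // t; exact: cvg_cst.
  move=> s; apply: (@continuous2_cvg _ G A A _ _ id (fun=> x) (@gact G A)).
  - exact: (@gact_continuous G A (s, x)).
  - exact: cvg_id.
  - exact: cvg_cst.
move=> s t; rewrite /Z1_act_fun acc gactA !gactM !mulgA.
suff E : gact s x * gact s x^-1 = 1.
  by rewrite -[_ * gact s x * gact s x^-1]mulgA E mulg1.
rewrite -gactM mulgV; apply: (mulgI (gact s 1)).
by rewrite -gactM !mulg1.
Qed.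

Definition Z1_act (a : Z1 A) (x : A) : Z1 A :=
  @exist _ (fun b => b \in @Z1_set A) _ (Z1_act_proof a x).

Lemma Z1_act1 a : Z1_act a 1 = a.
Proof.
apply: val_inj; apply: funext => s /=; rewrite /Z1_act_fun invg1 mul1g.
suff -> : gact s (1 : A) = 1 by rewrite mulg1.
by apply: (mulgI (gact s 1)); rewrite -gactM !mulg1.
Qed.

Lemma Z1_actM a x y : Z1_act a (x * y) = Z1_act (Z1_act a x) y.
Proof.
apply: val_inj; apply: funext => s /=.
by rewrite /Z1_act_fun gactM invgM !mulgA.
Qed.

Definition cohomologous : rel (Z1 A) :=
  fun a b => `[< exists x : A, b = Z1_act a x >].

Lemma cohomologous_refl : reflexive cohomologous.
Proof. by move=> a; apply/asboolP; exists 1; rewrite Z1_act1. Qed.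

Lemma cohomologous_sym : symmetric cohomologous.
Proof.
by move=> a b; apply/asboolP/asboolP => -[x ->]; exists x^-1;
  rewrite -Z1_actM mulgV Z1_act1.
Qed.

Lemma cohomologous_trans : transitive cohomologous.
Proof.
move=> b a c /asboolP[x ->] /asboolP[y ->]; apply/asboolP; exists (x * y).
by rewrite Z1_actM.
Qed.

Canonical cohomologous_equiv := EquivRel cohomologous
  cohomologous_refl cohomologous_sym cohomologous_trans.

Definition H1 : topologicalType := quotient_topology {eq_quot cohomologous}.

Definition cclass (a : Z1 A) : H1 := \pi_{eq_quot cohomologous} a.

End Action.

Section Functoriality.
Variables (A B : gGroupType G) (f : gGroupHom A B).

Definition Z1_map_fun (a : G -> A) : {ptws G -> B} := f \o a.

Lemma Z1_map_proof (a : Z1 A) : Z1_map_fun (\val a) \in @Z1_set B.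
Proof.
case: a => a /= /set_mem [ac acc]; apply/mem_set; split.
  by move=> s; apply: continuous_comp; [exact: ac | exact: cts_fun].
by move=> s t; rewrite /Z1_map_fun /= acc gmulfM /= gact_equivariant.
Qed.

Definition Z1_map (a : Z1 A) : Z1 B :=
  @exist _ (fun b => b \in @Z1_set B) _ (Z1_map_proof a).

Definition H1_map : H1 A -> H1 B :=
  fun c => cclass (Z1_map (repr (c : {eq_quot @cohomologous A}))).

Lemma gmulf1_hom : f 1 = 1.
Proof. by apply: (mulgI (f 1)); rewrite -gmulfM !mulg1. Qed.

Lemma gmulfV_hom x : f x^-1 = (f x)^-1.
Proof. by apply: (mulgI (f x)); rewrite -gmulfM !mulgV; exact: gmulf1_hom. Qed.

Lemma Z1_map_act a x : Z1_map (Z1_act a x) = Z1_act (Z1_map a) (f x).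
Proof.
apply: val_inj; apply: funext => s /=.
by rewrite /Z1_map_fun /Z1_act_fun /= !gmulfM /= gmulfV_hom gact_equivariant.
Qed.

(* [H1_map] does not depend on the choice of representatives. *)
Lemma H1_mapE a : H1_map (cclass a) = cclass (Z1_map a).
Proof.
rewrite /H1_map; set b := repr _.
have /eqmodP/asboolP[x ->] : b = a %[mod {eq_quot @cohomologous A}].
  by rewrite /b reprK.
by apply/eqmodP/asboolP; exists (f x); rewrite Z1_map_act.
Qed.

End Functoriality.
End Cohomology.

(* Main.v *)
Require Import Defs.
From HB Require Import structures.
From mathcomp Require Import all_boot all_order.
From mathcomp Require Import all_classical topology.

Set Implicit Arguments.
Unset Strict Implicit.
Unset Printing Implicit Defensive.

Local Open Scope classical_set_scope.
Local Open Scope group_scope.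
Local Open Scope quotient_scope.

(** Everything rests on the fact that an inverse limit of nonempty compact
    Hausdorff spaces is nonempty ([inverse_limit_nonempty]).  Cohomology classes
    involve a choice of a representative, or of a coboundary, at each level;
    compactness of the groups [A_ r] makes these choices compatible.

    Injectivity ([H1_to_limit_inj]): if the images of the cocycles [a] and [b]
    are cohomologous in every [A_ r], then the elements of [A_ r] that carry the
    image of [a] to the image of [b] form a nonempty closed subset of [A_ r].
    These subsets form an inverse system, and a point of its limit is an element
    of [A] that carries [a] to [b].

    Surjectivity ([H1_to_limit_surj]): a class in the cohomology of [A_ r] is an
    orbit of [A_ r] in [Z1 (A_ r)], hence a compact set of cocycles.  For a
    compatible family of classes these orbits form an inverse system, and a
    point of its limit is a compatible family of cocycles.  As [A] carries the
    limit topology and the limit group structure, this family glues to a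
    continuous cocycle with values in [A].

    Continuity is formal, by the universal properties of the subspace, product
    and quotient topologies.

    Homeomorphism ([H1_to_limit_homeomorphism]): a continuous bijection from a
    compact space to a Hausdorff space is a homeomorphism.  The target is
    Hausdorff because the orbit space of a Hausdorff space under a compact group
    is Hausdorff ([H1_hausdorff]).  The source is compact by an argument in the
    style of Ascoli: pointwise limits of an evenly continuous family are
    continuous ([evenly_continuous_closure]), so the cocycles form a closed
    subset of the compact space of all maps from [G] to [A] ([Z1_compact]). *)

(** * Products, subspaces and compactness *)

Lemma continuous_prod_topology (I : Type) (X : I -> topologicalType)
    (T : topologicalType) (f : T -> prod_topology X) :
  (forall i, continuous (fun t => f t i)) -> continuous f.
Proof.
move=> cf t; apply/cvg_sup => i.
exact: (@continuous_comp_initial _ T (X i) (fun g : prod_topology X => g i) f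
  (cf i) t).
Qed.

Lemma prod_eval_continuous (I : eqType) (X : I -> topologicalType) (i : I) :
  continuous (fun f : prod_topology X => f i).
Proof. exact: (@proj_continuous I X i). Qed.

Lemma set_val_continuous (X : topologicalType) (S : set X) :
  continuous (\val : set_type S -> X).
Proof. exact: (@initial_continuous _ X (\val : set_type S -> X)). Qed.

Lemma continuous_set_type (T X : topologicalType) (S : set X)
    (f : T -> set_type S) :
  continuous (fun t => \val (f t)) -> continuous f.
Proof. exact: (@continuous_comp_initial _ T X (\val : set_type S -> X)). Qed.

Lemma compact_set_type (X : topologicalType) (S : set X) :
  compact S -> compact [set: set_type S].
Proof.
move=> cS F PF _.
have FS : ((\val : set_type S -> X) @ F) S.
  by apply: (@filterS _ F _ setT _ _ filterT) => x _; exact: set_valP.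
have [p [Sp clp]] := cS _ _ FS.
exists (exist _ p (mem_set Sp)); split=> // C D FC [_ [[O oO <-] /= Op] OD].
have FvC : ((\val : set_type S -> X) @ F) (\val @` C).
  by apply: (@filterS _ F _ C _ _ FC) => x Cx; exists x.
have [q [[/= x Cx xq] Oq]] := clp _ O FvC (open_nbhs_nbhs (conj oO Op)).
by exists x; split => //; apply: OD; move: Oq; rewrite -xq.
Qed.

Lemma continuous_fix_left (X Y Z : topologicalType) (h : X -> Y -> Z) (x : X) :
  continuous (fun p : X * Y => h p.1 p.2) -> continuous (h x).
Proof.
move=> ch y N Nxy; have [[P Q] [/= Px Qy] PQ] := ch (x, y) N Nxy.
apply: filterS Qy => y' Qy'; apply: (PQ (x, y')); split=> //.
exact: nbhs_singleton.
Qed.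

Lemma continuous_fix_right (X Y Z : topologicalType) (h : X -> Y -> Z) (y : Y) :
  continuous (fun p : X * Y => h p.1 p.2) -> continuous (h^~ y).
Proof.
move=> ch x N Nxy; have [[P Q] [/= Px Qy] PQ] := ch (x, y) N Nxy.
apply: filterS Px => x' Px'; apply: (PQ (x', y)); split=> //.
exact: nbhs_singleton.
Qed.

Lemma hausdorff_set_type (X : topologicalType) (S : set X) :
  hausdorff_space X -> hausdorff_space (set_type S).
Proof.
move=> hX p q pq; apply: val_inj; apply: hX => U V Up Vq.
have [x [Ux Vx]] :=
  pq _ _ (@set_val_continuous X S p U Up) (@set_val_continuous X S q V Vq).
by exists (\val x).
Qed.

Lemma closed_eqfun (X Y : topologicalType) (f g : X -> Y) :
  hausdorff_space Y -> continuous f -> continuous g ->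
  closed [set x | f x = g x].
Proof.
move=> hY cf cg x clx; apply: hY => U V Uf Vg.
have fgUV : nbhs x (f @^-1` U `&` g @^-1` V).
  by apply: filterI; [exact: cf Uf | exact: cg Vg].
have [y [/= fg [Uy Vy]]] := clx _ fgUV.
by exists (f y); split => //; rewrite fg.
Qed.

(** The inverse is continuous because the map is closed: closed subsets of the
    source are compact, and compact subsets of the target are closed. *)
Lemma compact_hausdorff_homeomorphism (X Y : topologicalType) (f : X -> Y) :
  compact [set: X] -> hausdorff_space Y -> continuous f -> bijective f ->
  homeomorphism f.
Proof.
move=> cX hY cf [g fK gK]; split=> //; exists g; split=> //.
apply/continuous_closedP => C clC.
have -> : g @^-1` C = f @` C.
  rewrite eqEsubset; split=> [y Cy|_ [x Cx <-]]; last by rewrite /preimage/= fK.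
  by exists (g y); rewrite ?gK.
apply: compact_closed => //; apply: continuous_compact.
  exact: continuous_subspaceT.
exact: subclosed_compact cX _.
Qed.

(** In the product of the [K r], which is compact by Tychonoff's theorem, let
    [E t] be the set of the families whose entries below [t] are the images of
    the entry at [t].  It is closed and nonempty, and it shrinks as [t] grows, so
    that the [E t] generate a filter; a cluster point of it belongs to every
    [E t].  The sets [K r] live in ambient spaces [X r] so that the lemma
    produces a point of a given limit subject to constraints at each level. *)
Lemma inverse_limit_nonempty {d : Order.disp_t} (R : porderType d)
    (X : R -> topologicalType) (f : forall r s, (s <= r)%O -> X r -> X s)
    (K : forall r, set (X r)) :
  directed R -> is_inverse_system f ->
  (forall r s sr, continuous (f r s sr)) ->
  (forall r, hausdorff_space (X r)) ->
  (forall r, compact (K r)) -> (forall r, K r !=set0) ->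
  (forall r s sr x, K r x -> K s (f r s sr x)) ->
  exists2 x : prod_topology X, inverse_limit f x & forall r, K r (x r).
Proof.
move=> dirR [fid fcomp] fcts hX Kco K0 fK.
pose k r := projT1 (cid (K0 r)).
have Kk r : K r (k r) by exact: projT2 (cid (K0 r)).
(* Without indices there is no [E t] to form a proper filter; any family will
   do. *)
have [[r0]|noR] := pselect (inhabited R); last first.
  by exists k => // r; case: noR.
pose E t : set (prod_topology X) := [set x | (forall r, K r (x r)) /\
  forall r (rt : (r <= t)%O), f t r rt (x t) = x r].
have E0 t : E t !=set0.
  (* Below [t], project the point chosen at [t]; elsewhere any point of [K r]
     will do. *)
  exists (fun r => if pselect (r <= t)%O is left rt then f t r rt (k t)
                   else k r); split=> [r|r rt].
    by case: pselect => [rt|_]; [exact: fK | exact: Kk].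
  case: pselect => [tt|/(_ (Order.le_refl t))//].
  case: pselect => [rt'|/(_ rt)//].
  by rewrite fid (bool_irrelevance rt rt').
have subE t t' : (t <= t')%O -> E t' `<=` E t.
  move=> tt' x [Kx xE]; split=> // r rt.
  by rewrite -(xE t tt') (fcomp _ _ _ _ _ (Order.le_trans rt tt')) xE.
have FE : ProperFilter (filter_from [set: R] E).
  apply: filter_from_proper => //; apply: filter_from_filter; first by exists r0.
  move=> r s _ _; have [t [rt st]] := dirR r s.
  by exists t => // x Ex; split; [exact: subE rt _ Ex | exact: subE st _ Ex].
have [|x [Kx clx]] := tychonoff Kco FE.
  by exists r0 => // x [].
exists x => // t r rt.
have : closure (E t) x by move=> N Nx; apply: clx => //; exists t.
have clE := @closed_eqfun (prod_topology X) (X r)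
  (fun y => f t r rt (y t)) (fun y => y r) (hX r).
move=> cEx; apply: clE; last first.
- by apply: closureS cEx => y [_ yE]; exact: yE.
- exact: prod_eval_continuous.
- move=> y; apply: continuous_comp; last exact: fcts.
  exact: prod_eval_continuous.
Qed.

(** Even continuity bounds [g @` V] inside a neighbourhood [U1] of [f b] for all
    members [g] of the family with [g b] close to [f b]; such [g] approximate [f]
    at any point of [V], so [f] maps [V] into the closure of [U1], and
    regularity allows that closure to be prescribed. *)
Lemma evenly_continuous_closure (B A : topologicalType)
    (F : set {ptws B -> A}) :
  @regular_space A -> evenly_continuous F ->
  closure F `<=` @Mcts B A.
Proof.
move=> regA evF f clf b U Uf.
have [U1 U1f U1U] := regA _ _ Uf.
have [V [W [Vb Wf FVW]]] := evF b (f b) U1 U1f.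
apply: filterS Vb => v Vv; apply: U1U => N Nfv.
have WN : nbhs f [set g : {ptws B -> A} | W (g b) /\ N (g v)].
  apply: filterI; first exact: (@prod_eval_continuous B (fun=> A) b f).
  exact: (@prod_eval_continuous B (fun=> A) v f).
have [g [Fg [Wg Ng]]] := clf _ WN.
by exists (g v); split=> //; apply: (FVW g) => //; exists v.
Qed.

(** * Spaces of cocycles and of cohomology classes *)

Section Cohomology.
Context {G : topologicalGroupType}.

Lemma gact_slice_continuous (A : gGroupType G) (s : G) :
  continuous (gact s : A -> A).
Proof. exact: continuous_fix_left (@gact_continuous G A). Qed.

Lemma Z1_eval_continuous (A : gGroupType G) (s : G) :
  continuous (fun a : Z1 A => \val a s).
Proof.
move=> a; apply: (@continuous_comp (Z1 A) {ptws G -> A} A \val (fun f => f s)).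
  exact: set_val_continuous.
exact: (@prod_eval_continuous G (fun=> A)).
Qed.

Lemma continuous_Z1 (T : topologicalType) (A : gGroupType G) (f : T -> Z1 A) :
  (forall s, continuous (fun t => \val (f t) s)) -> continuous f.
Proof.
move=> cf; apply: continuous_set_type.
exact: (@continuous_prod_topology G (fun=> A)).
Qed.

Lemma Z1_hausdorff (A : gGroupType G) : hausdorff_space (Z1 A).
Proof.
apply: hausdorff_set_type.
by apply: (@hausdorff_product G (fun=> A)) => _; exact: ggroup_hausdorff.
Qed.

Lemma Z1_act_continuous (A : gGroupType G) :
  continuous (fun p : Z1 A * A => Z1_act p.1 p.2).
Proof.
apply: continuous_Z1 => s; apply: mulg_cvg; first apply: mulg_cvg.
- move=> p.
  apply: (@continuous_comp (Z1 A * A)%type A A snd (fun x => x^-1)).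
    exact: cvg_snd.
  exact: invg_continuous.
- move=> p.
  apply: (@continuous_comp (Z1 A * A)%type (Z1 A) A fst (fun a => \val a s)).
    exact: cvg_fst.
  exact: Z1_eval_continuous.
- move=> p; apply: (@continuous_comp (Z1 A * A)%type A A snd (gact s)).
    exact: cvg_snd.
  exact: gact_slice_continuous.
Qed.

Lemma Z1_act_orbit_continuous (A : gGroupType G) (a : Z1 A) :
  continuous (Z1_act a).
Proof. exact: continuous_fix_left (@Z1_act_continuous A). Qed.

Lemma Z1_act_trans_continuous (A : gGroupType G) (x : A) :
  continuous (fun a : Z1 A => Z1_act a x).
Proof. exact: continuous_fix_right (@Z1_act_continuous A). Qed.

Lemma cclassP (A : gGroupType G) (a b : Z1 A) :
  cclass a = cclass b <-> exists x, b = Z1_act a x.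
Proof. by split=> [/eqmodP/asboolP|ab] //; apply/eqmodP/asboolP. Qed.

Lemma cclass_surj (A : gGroupType G) (c : H1 A) : exists a, cclass a = c.
Proof. by exists (repr (c : {eq_quot @cohomologous G A})); exact: reprK. Qed.

Lemma cclass_continuous (A : gGroupType G) : continuous (@cclass G A).
Proof. exact: (@pi_continuous (Z1 A) {eq_quot @cohomologous G A}). Qed.

Lemma continuous_H1 (A : gGroupType G) (T : topologicalType) (f : H1 A -> T) :
  continuous (fun a => f (cclass a)) -> continuous f.
Proof.
by move=> cf; apply/(@quotient_continuous (Z1 A) {eq_quot @cohomologous G A}).
Qed.

(** The saturation of [U] is the union of its translates by the group [A], which
    acts by homeomorphisms. *)
Lemma cclass_open (A : gGroupType G) (U : set (Z1 A)) :
  open U -> open (@cclass G A @` U : set (H1 A)).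
Proof.
move=> oU; rewrite /open /= /quotient_open.
have -> : \pi_(H1 A) @^-1` (@cclass G A @` U) =
    \bigcup_(x in [set: A]) (fun a : Z1 A => Z1_act a x) @^-1` U.
  rewrite eqEsubset; split=> [b [a Ua /esym/cclassP[x ax]]|b [x _ Ub]].
    by exists x => //; rewrite /preimage /= -ax.
  by exists (Z1_act b x) => //; apply/esym/cclassP; exists x.
apply: bigcup_open => x _; apply: open_comp oU => a _.
exact: Z1_act_trans_continuous.
Qed.

(** If [b] is not in the orbit of [a], then for each [x] in [A] neighbourhoods of
    [a], [x] and [b] witness that the cocycles near [b] are not translates of
    cocycles near [a] by elements near [x].  Compactness of [A] makes the
    neighbourhoods of [a] and [b] uniform in [x]; their images in the quotient
    are open by [cclass_open] and disjoint. *)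
Lemma H1_hausdorff (A : gGroupType G) :
  compact [set: A] -> hausdorff_space (H1 A).
Proof.
move=> /compact_near_coveringP cA p q.
have [a <-] := cclass_surj p; have [b <-] := cclass_surj q => clab.
apply: contrapT => /cclassP nab.
have := cA (Z1 A * Z1 A)%type (nbhs (a, b))
  (fun uv x => uv.2 <> Z1_act uv.1 x) _.
case=> [x _|[U V] /= [Ua Vb] UV].
  have hZ := @Z1_hausdorff A (Z1_act a x) b.
  have /existsNP[N /existsNP[M /not_implyP[Nax /not_implyP[Mb NM]]]] :
    ~ cluster (nbhs (Z1_act a x)) b by move=> /hZ/esym abx; apply: nab; exists x.
  have [[P Q] [/= Pa Qx] PQ] := @Z1_act_continuous A (a, x) N Nax.
  exists (Q, P `*` M); first by split=> //; exists (P, M).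
  move=> [x' [u v]] /= [Qx' [Pu Mv]] vE; apply: NM; exists v; split=> //.
  by rewrite vE; exact: (PQ (u, x')).
move: Ua Vb; rewrite !nbhsE => -[U' [oU U'a] U'U] [V' [oV V'b] V'V].
have [] := clab (@cclass G A @` U') (@cclass G A @` V').
- by apply: open_nbhs_nbhs; split; [exact: cclass_open | exists a].
- by apply: open_nbhs_nbhs; split; [exact: cclass_open | exists b].
move=> _ [[u Uu <-] [v Vv /esym/cclassP[x vE]]].
by apply: (UV (u, v)) vE => //; split; [exact: U'U | exact: V'V].
Qed.

(** The cocycle identity is a closed condition in the compact space of all maps,
    and so is continuity, by even continuity. *)
Lemma Z1_compact (A : gGroupType G) :
  compact [set: A] -> evenly_continuous_wrt A G -> compact [set: Z1 A].
Proof.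
move=> cA evA; apply: compact_set_type.
have hA := @ggroup_hausdorff G A.
have cAG : compact [set: {ptws G -> A}].
  have := @tychonoff G (fun=> A) (fun=> setT) (fun=> cA).
  by congr (compact _); rewrite eqEsubset.
apply: subclosed_compact cAG _ => // f clf; split.
  apply: (evenly_continuous_closure _ evA).
    by move=> x; exact: compact_regular hA cA filterT.
  by apply: closureS clf => g [].
move=> s t.
have := @closed_eqfun {ptws G -> A} A
  (fun g => g (s * t)) (fun g => g s * gact s (g t)) hA.
apply.
- exact: (@prod_eval_continuous G (fun=> A)).
- apply: mulg_cvg; first exact: (@prod_eval_continuous G (fun=> A)).
  move=> g.
  apply: (@continuous_comp {ptws G -> A} A A (fun h => h t) (gact s));
    last exact: gact_slice_continuous.
  exact: (@prod_eval_continuous G (fun=> A)).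
- by apply: closureS clf => g [_ gE]; exact: gE.
Qed.

Lemma Z1_map_continuous (A B : gGroupType G) (f : gGroupHom A B) :
  continuous (Z1_map f).
Proof.
apply: continuous_Z1 => s a.
apply: (@continuous_comp (Z1 A) A B (fun b => \val b s) f).
  exact: Z1_eval_continuous.
exact: cts_fun.
Qed.

Lemma H1_map_continuous (A B : gGroupType G) (f : gGroupHom A B) :
  continuous (H1_map f).
Proof.
apply: continuous_H1.
rewrite (_ : (fun _ => _) = @cclass G B \o Z1_map f); last first.
  by apply: funext => a; exact: H1_mapE.
move=> a; apply: (@continuous_comp (Z1 A) (Z1 B) (H1 B) (Z1_map f)).
  exact: Z1_map_continuous.
exact: cclass_continuous.
Qed.

(** * Passage to the inverse limit *)

Section Limit.
Context {d : Order.disp_t} (R : porderType d) (A_ : R -> gGroupType G).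
Variable phi_ : forall r s : R, (s <= r)%O -> gGroupHom (A_ r) (A_ s).
Variables (A : gGroupType G) (phi : forall r : R, gGroupHom A (A_ r)).
Hypothesis limA : is_inverse_limit phi_ phi.

Lemma limit_compat r s (sr : (s <= r)%O) x : phi_ sr (phi r x) = phi s x.
Proof.
have [Phi [_ PhiE]] := limA; rewrite -!PhiE.
exact: (set_valP (Phi x)).
Qed.

Lemma Z1_map_compat r s (sr : (s <= r)%O) (a : Z1 A) :
  Z1_map (phi_ sr) (Z1_map (phi r) a) = Z1_map (phi s) a.
Proof. by apply: val_inj; apply: funext => g; exact: limit_compat. Qed.

Lemma limit_inj x y : (forall r, phi r x = phi r y) -> x = y.
Proof.
have [Phi [[_ [Psi [_ PhiK _]]] PhiE]] := limA => xy.
apply: (can_inj PhiK); apply: val_inj.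
by apply: functional_extensionality_dep => r; rewrite !PhiE xy.
Qed.

Lemma limit_lift (y : prod_topology A_) :
  inverse_limit phi_ y -> exists x, forall r, phi r x = y r.
Proof.
have [Phi [[_ [Psi [_ _ PsiK]]] PhiE]] := limA => Ly.
by exists (Psi (exist _ y (mem_set Ly))) => r; rewrite -PhiE PsiK.
Qed.

Lemma limit_continuous (T : topologicalType) (f : T -> A) :
  (forall r, continuous (fun t => phi r (f t))) -> continuous f.
Proof.
have [Phi [[_ [Psi [Psicts PhiK _]]] PhiE]] := limA => cf.
rewrite (_ : f = Psi \o (Phi \o f)); last first.
  by apply: funext => t; rewrite /= PhiK.
move=> t; apply: continuous_comp; last exact: Psicts.
move: t; apply: continuous_set_type.
apply: (@continuous_prod_topology R A_) => r.
by under eq_fun do rewrite /= PhiE; exact: cf.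
Qed.

Lemma Z1_map_system :
  is_inverse_system phi_ ->
  is_inverse_system (fun r s (sr : (s <= r)%O) => Z1_map (phi_ sr)).
Proof.
move=> [fid fcomp]; split=> [r rr a|r s t sr ts tr a];
  apply: val_inj; apply: funext => g; [exact: fid|exact: fcomp].
Qed.

Lemma H1_map_limit (c : H1 A) :
  inverse_limit (fun r s (sr : (s <= r)%O) => H1_map (phi_ sr))
    (fun r => H1_map (phi r) c).
Proof.
move=> r s sr; have [a <-] := cclass_surj c; rewrite !H1_mapE; congr cclass.
exact: Z1_map_compat.
Qed.

Definition H1_to_limit (c : H1 A) :
    inverse_limit (fun r s (sr : (s <= r)%O) => H1_map (phi_ sr)) :=
  exist _ (_ : prod_topology (fun r => H1 (A_ r))) (mem_set (H1_map_limit c)).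

Lemma H1_to_limit_continuous : continuous H1_to_limit.
Proof.
apply: continuous_set_type.
apply: (@continuous_prod_topology R (fun r => H1 (A_ r))) => r /=.
exact: H1_map_continuous.
Qed.

Hypotheses (dirR : directed R) (sysA : is_inverse_system phi_).
Hypothesis cA_ : forall r, compact [set: A_ r].

(** A cohomology between [a] and [b] is found as a point of the limit of the
    transporters [K r] from the image of [a] to the image of [b]. *)
Lemma H1_to_limit_inj : injective H1_to_limit.
Proof.
move=> c1 c2; have [a <-] := cclass_surj c1; have [b <-] := cclass_surj c2.
move=> /(congr1 \val) /= ab.
have {}ab r : exists x, Z1_map (phi r) b = Z1_act (Z1_map (phi r) a) x.
  by apply/cclassP; rewrite -!H1_mapE; exact: (congr1 (fun y => y r) ab).
pose K r := [set x | Z1_map (phi r) b = Z1_act (Z1_map (phi r) a) x].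
have [||r|r|r s sr x Kx|x Lx Kx] :=
  @inverse_limit_nonempty d R A_ phi_ K dirR sysA.
- by move=> r s sr; exact: cts_fun.
- by move=> r; exact: ggroup_hausdorff.
- apply: (@subclosed_compact _ (K r) [set: A_ r]) => //.
  apply: closed_eqfun; first exact: Z1_hausdorff.
    by move=> x; exact: cvg_cst.
  exact: Z1_act_orbit_continuous.
- exact: ab.
- by rewrite /K /= -(Z1_map_compat sr b) Kx Z1_map_act Z1_map_compat.
have [z zE] := limit_lift Lx.
apply/cclassP; exists z; apply: val_inj; apply: funext => s.
apply: limit_inj => r.
have /(congr1 (fun u : Z1 (A_ r) => \val u s)) :
  Z1_map (phi r) b = Z1_map (phi r) (Z1_act a z) by rewrite Z1_map_act zE Kx.
by [].
Qed.

(** Compatible cocycles are found as a point of the limit of the orbits [K r],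
    and glued pointwise in [G]. *)
Lemma H1_to_limit_surj y : exists c, H1_to_limit c = y.
Proof.
have Ly := set_valP y.
pose K r := [set a : Z1 (A_ r) | cclass a = \val y r].
have [||r|r|r s sr a Ka|a La Ka] :=
  @inverse_limit_nonempty d R (fun r => Z1 (A_ r))
    (fun r s (sr : (s <= r)%O) => Z1_map (phi_ sr)) K dirR (Z1_map_system sysA).
- by move=> r s sr; exact: Z1_map_continuous.
- by move=> r; exact: Z1_hausdorff.
- have [a0 a0E] := cclass_surj (\val y r).
  have -> : K r = Z1_act a0 @` setT.
    rewrite eqEsubset; split=> [b|_ [x _ <-]]; rewrite /K /= -a0E.
      by move=> /esym/cclassP[x ->]; exists x.
    by apply/esym/cclassP; exists x.
  apply: (@continuous_compact (A_ r) _ _ [set: A_ r]); last exact: cA_.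
  by apply: continuous_subspaceT; exact: Z1_act_orbit_continuous.
- by have [a0 a0E] := cclass_surj (\val y r); exists a0.
- by rewrite /K /= -H1_mapE Ka; exact: Ly.
have /choice[b bE] s : exists x, forall r, phi r x = \val (a r) s.
  apply: limit_lift => r t tr.
  by have /(congr1 (fun u : Z1 (A_ t) => \val u s)) := La r t tr.
have Zb : @Z1_set G A b.
  split=> [|s t].
    apply: limit_continuous => r; under eq_fun do rewrite bE.
    by have [] := set_valP (a r).
  apply: limit_inj => r; rewrite gmulfM /= gact_equivariant !bE.
  by have [_ ] := set_valP (a r); apply.
exists (cclass (exist _ b (mem_set Zb) : Z1 A)); apply: val_inj.
apply: functional_extensionality_dep => r /=.
rewrite H1_mapE -Ka; congr cclass; apply: val_inj; apply: funext => s.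
exact: bE.
Qed.

Lemma H1_to_limit_bij : bijective H1_to_limit.
Proof.
rewrite -setTT_bijective; split=> // [x y _ _ /H1_to_limit_inj//|y _].
by have [c <-] := H1_to_limit_surj y; exists c.
Qed.

Lemma H1_to_limit_homeomorphism :
  compact [set: A] -> evenly_continuous_wrt A G -> homeomorphism H1_to_limit.
Proof.
move=> cA evA; apply: compact_hausdorff_homeomorphism.
- rewrite (_ : setT = @cclass G A @` setT); last first.
    by rewrite eqEsubset; split=> // c _; have [a <-] := cclass_surj c; exists a.
  apply: (@continuous_compact (Z1 A) _ _ [set: Z1 A]); last exact: Z1_compact.
  by apply: continuous_subspaceT; exact: cclass_continuous.
- apply: hausdorff_set_type.
  by apply: (@hausdorff_product R) => r; exact: H1_hausdorff.
- exact: H1_to_limit_continuous.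
- exact: H1_to_limit_bij.
Qed.

End Limit.
End Cohomology.

Theorem theorem1 (G : topologicalGroupType)
    (d : Order.disp_t) (R : porderType d)
    (A_ : R -> gGroupType G)
    (phi_ : forall r s : R, (s <= r)%O -> gGroupHom (A_ r) (A_ s))
    (A : gGroupType G) (phi : forall r : R, gGroupHom A (A_ r)) :
  directed R ->
  is_inverse_system phi_ ->
  (forall r : R, compact [set: A_ r]) ->
  compact [set: A] ->
  is_inverse_limit phi_ phi ->
  exists Theta : H1 A -> inverse_limit (fun r s sr => H1_map (phi_ r s sr)),
    [/\ forall (a : Z1 A) (r : R),
          \val (Theta (cclass a)) r = cclass (Z1_map (phi r) a),
        continuous Theta,
        bijective Theta &
        hausdorff_space G ->
        compact [set: G] \/ locally_compact [set: G] ->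
        evenly_continuous_wrt A G ->
        homeomorphism Theta].
Proof.
move=> dirR sysA cA_ cA limA; exists (H1_to_limit limA); split.
- by move=> a r; exact: H1_mapE.
- exact: H1_to_limit_continuous.
- exact: H1_to_limit_bij.
- by move=> _ _; exact: H1_to_limit_homeomorphism.
Qed.
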